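(* Let $n\ge2$, let $(X,F)$ be a symmetric $n$-ary band with associated binary band $(X,B)$, and let $\sigma$ be the least semilattice congruence on $(X,B)$, with $[x]$ denoting the $\sigma$-class of $x\in X$. For any $x\in X$, $([x],F|_{[x]^n})$ is the $n$-ary extension of an Abelian group whose exponent divides $n-1$.
   Context: An operation $F\colon X^n\to X$ ($X$ nonempty) is associative if $F(x_1,\ldots,x_{i-1},F(x_i,\ldots,x_{i+n-1}),x_{i+n},\ldots,x_{2n-1})=F(x_1,\ldots,x_i,F(x_{i+1},\ldots,x_{i+n}),x_{i+n+1},\ldots,x_{2n-1})$ for all $x_1,\ldots,x_{2n-1}\in X$ and $1\le i\le n-1$. A symmetric $n$-ary band is a pair $(X,F)$ with $F$ associative, invariant under permutations of its arguments, and idempotent ($F(x,\ldots,x)=x$ for all $x$). The associated binary operation is $B(x,y)=F(x,\ldots,x,y)$, with $x$ repeated $n-1$ times; $(X,B)$ is a right normal band, i.e. an idempotent semigroup with $B(B(x,y),z)=B(B(y,x),z)$ for all $x,y,z$. A semilattice congruence on $(X,B)$ is a congruence whose quotient is a semilattice (commutative idempotent semigroup). The least one, $\sigma$, is given (because $(X,B)$ is a right normal band) by: $x\,\sigma\,y$ if and only if $B(y,x)=x$ and $B(x,y)=y$. The relation $\sigma$ is also a congruence for $F$, so that (by idempotency) $F$ restricts to an operation on each class $[x]$. The $n$-ary extension of a semigroup $(S,\ast)$ is $(S,H)$ with $H(s_1,\ldots,s_n)=s_1\ast\cdots\ast s_n$. The exponent of a group divides $n-1$ means that $x^{n-1}$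 is the neutral element for every $x$. *)

(* Defs.v *)
From mathcomp Require Import all_boot all_fingroup all_algebra.
From Corelib Require Import Classes.RelationClasses.

Set Implicit Arguments.
Unset Strict Implicit.
Unset Printing Implicit Defensive.

Import GRing.Theory.

Local Open Scope nat_scope.

Section NaryBand.

Variables (X : Type) (n : nat) (F : n.-tuple X -> X).

(* F(x_0, ..., x_{p-1}, F(x_p, ..., x_{p+n-1}), x_{p+n}, ..., x_{2n-2}), with
   arguments numbered from 0; for p < n only x_0, ..., x_{2n-2} are read, so
   [x : nat -> X] stands for an arbitrary (2n-1)-tuple. *)
Definition nested (x : nat -> X) (p : nat) : X :=
  F [tuple (if k < p then x k
            else if k == p :> nat then F [tuple x (p + j) | j < n]
            else x (k + n.-1)) | k < n].

Definition nary_associative : Prop :=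
  forall (x : nat -> X) (p : nat), p.+1 < n -> nested x p = nested x p.+1.

Definition nary_symmetric : Prop :=
  forall (s : 'S_n) (t : n.-tuple X), F [tuple tnth t (s k) | k < n] = F t.

Definition nary_idempotent : Prop :=
  forall x : X, F [tuple x | _ < n] = x.

Definition symmetric_nary_band : Prop :=
  [/\ nary_associative, nary_symmetric & nary_idempotent].

(* F(x, ..., x, y), where x is repeated n - 1 times. *)
Definition assoc_binop (x y : X) : X :=
  F [tuple (if k < n.-1 then x else y) | k < n].

End NaryBand.

Section SemilatticeCongruence.

Variables (X : Type) (B : X -> X -> X).

Definition congruence (R : X -> X -> Prop) : Prop :=
  Equivalence R /\
  forall x x' y y' : X, R x x' -> R y y' -> R (B x y) (B x' y').

(* The last three conditions are the semilattice laws in the quotient by R. *)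
Definition semilattice_congruence (R : X -> X -> Prop) : Prop :=
  [/\ congruence R,
      forall x y z : X, R (B x (B y z)) (B (B x y) z),
      forall x y : X, R (B x y) (B y x)
    & forall x : X, R (B x x) x].

Definition least_semilattice_congruence (R : X -> X -> Prop) : Prop :=
  semilattice_congruence R /\
  forall R' : X -> X -> Prop, semilattice_congruence R' ->
    forall x y : X, R x y -> R' x y.

End SemilatticeCongruence.

Definition eq_class (X : Type) (R : X -> X -> Prop) (x : X) : Type :=
  {y : X | R x y}.

(* The existence of such an H contains the claim that [x] is closed under F. *)
Definition is_restriction (X : Type) (n : nat) (F : n.-tuple X -> X)
    (R : X -> X -> Prop) (x : X)
    (H : n.-tuple (eq_class R x) -> eq_class R x) : Prop :=
  forall s : n.-tuple (eq_class R x),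
    sval (H s) = F [tuple sval (tnth s k) | k < n].

(* Abelian groups are written additively, as usual for [zmodType]. *)
Definition nary_extension (G : zmodType) (n : nat) (s : n.-tuple G) : G :=
  (\sum_(k < n) tnth s k)%R.

Definition exponent_divides (G : zmodType) (m : nat) : Prop :=
  forall a : G, (a *+ m = 0)%R.

(* [GRing.Zmodule T] is the type of Abelian group structures on the carrier T;
   it includes a choice operator on T, which classically always exists. *)
Definition is_nary_extension_of_abelian_group (T : Type) (n : nat)
    (H : n.-tuple T -> T) (m : nat) : Prop :=
  exists cG : GRing.Zmodule T,
    let G : zmodType := GRing.Zmodule.Pack cG in
    (forall s : n.-tuple G, H s = nary_extension s) /\ exponent_divides G m.

(* Main.v *)
Require Import Defs.
From mathcomp Require Import all_boot all_fingroup all_algebra.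
From HB Require Import structures.
From mathcomp Require Import boolp.
From mathcomp Require Import zify.

(** Write n = q + 2.  Because [F] is associative and symmetric, the nested uses
    of [F] on a word of length 1 modulo q + 1 all give the same value, and
    this value depends only on the multiset of letters ([prodF_perm]).  So [F]
    may be handled like a commutative product that is defined only on words
    whose length is 1 modulo q + 1, and identities such as B x y = y x^(q+1)
    are checked by counting letters.

    The maps B x commute and are idempotent, and B (F (y_1, ..., y_n)) is the
    composite of the maps B y_i ([binop_prodFl]).  Hence x |-> B x
    sends [B] and [F] to composition in a semilattice of maps; its kernel
    [same_action] is a semilattice congruence, and it is contained in every
    other one, since B x = B y forces x = B x x = B y x and
    y = B y y = B x y, while B y x and B x y are identified in any
    commutative quotient.  So sigma is this kernel ([least_same_action]), and
    its classes are closed under [F] because idempotent maps compose to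
    themselves.

    In the class of e the letters satisfy x e^(q+1) = B e x = x: blocks of
    q + 1 letters e can be inserted and removed freely.  Therefore
    x + y := x y e^q is an Abelian group law with neutral element e; the
    opposite of x is x^q e^2, because x^(q+1) e = B x e = B e e = e.
    A sum of k elements is their product with k q + 1 letters e, one of which
    is the empty sum ([class_sum]).  For k = q + 2 there are (q + 1)^2 letters
    e, which can be removed, so the sum is the value of [F]; for q + 1 equal
    summands x there are q (q + 1) + 1 of them, and x^(q+1) e = e remains. *)

Set Implicit Arguments.
Unset Strict Implicit.
Unset Printing Implicit Defensive.

(** * Permutation invariance from adjacent transpositions *)

(** The length is fixed because a product of letters is only invariant on
    words of admissible length. *)
Lemma eq_swap_perm (T : eqType) (R : Type) (N : nat) (f : seq T -> R) :
  (forall p x y r, size (p ++ x :: y :: r) = N ->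
     f (p ++ x :: y :: r) = f (p ++ y :: x :: r)) ->
  forall s t, perm_eq s t -> size s = N -> f s = f t.
Proof.
move=> f_swap s; elim: s N f f_swap => [|x s IHs] N f f_swap t eq_st szN.
  by move: eq_st; rewrite perm_sym => /perm_nilP ->.
have /path.splitPr tE : x \in t by rewrite -(perm_mem eq_st) mem_head.
case: tE eq_st => t1 t2.
rewrite perm_sym perm_catC cat_cons perm_cons perm_catC perm_sym => eq_st.
case: N f_swap szN => // N f_swap [szN].
rewrite (IHs N (fun w => f (x :: w)) _ _ eq_st szN); last first.
  by move=> p y z r szr; rewrite -!cat_cons; apply: f_swap; rewrite /= szr.
have szt : size (x :: t1 ++ t2) = N.+1 by rewrite /= -(perm_size eq_st) szN.
suff move_x p : size (p ++ x :: t1 ++ t2) = N.+1 ->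
    f (p ++ x :: t1 ++ t2) = f (p ++ t1 ++ x :: t2) by apply: (move_x [::]).
elim: t1 p {eq_st szt} => [|y t1 IHt] p //= szp.
rewrite f_swap // -cat_rcons IHt ?cat_rcons //.
by rewrite -szp !size_cat.
Qed.

(** * Abelian groups on arbitrary types *)

(** The choice operator comes from the axiom of choice.  Zero and
    addition are exposed because they determine all iterated sums; opposites are
    then determined as well. *)
Lemma abelian_group_on (T : Type) (zero : T) (opp : T -> T)
    (add : T -> T -> T) :
  associative add -> commutative add -> left_id zero add ->
  left_inverse zero opp add ->
  exists cG : GRing.Zmodule T,
    let G : zmodType := GRing.Zmodule.Pack cG in
    (0%R = zero :> G) /\ forall x y : G, (x + y)%R = add x y.
Proof.
move=> addA addC add0 addN.
pose cT : choiceType := HB.pack T (gen_eqMixin T) (gen_choiceMixin T).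
pose zmodT := @GRing.isZmodule.Build cT zero opp add addA addC add0 addN.
pose G : zmodType := HB.pack T (Choice.class cT) zmodT.
by exists (GRing.Zmodule.class G).
Qed.

Lemma sval_inj (T : Type) (P : T -> Prop) : injective (@sval T P).
Proof.
by move=> [x Px] [y Py] /= exy; case: y / exy Py => Py; congr exist.
Qed.

(** * Products of words in a symmetric n-ary band *)

Section SymmetricBand.

Variables (X : eqType) (q : nat) (F : q.+2.-tuple X -> X).
Hypothesis F_assoc : nary_associative F.
Hypothesis F_sym : nary_symmetric F.
Hypothesis F_idem : nary_idempotent F.

(** [F] on lists of length n; the default [d] makes it total, and
    [seqF_perm] shows that it does not affect the value at that length. *)
Definition seqF (d : X) (s : seq X) : X := F [tuple nth d s k | k < q.+2].

Lemma seqF_tuple (d : X) (t : q.+2.-tuple X) : seqF d t = F t.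
Proof.
by congr F; apply: eq_from_tnth => i; rewrite tnth_mktuple -tnth_nth.
Qed.

Lemma seqF_perm (d1 d2 : X) (s t : seq X) :
  size s = q.+2 -> perm_eq s t -> seqF d1 s = seqF d2 t.
Proof.
move=> szs eq_st; have szt : size t == q.+2 by rewrite -(perm_size eq_st) szs.
move/eqP: szs => szs.
have /tuple_permP [p ->] : perm_eq s (Tuple szt) by [].
by rewrite seqF_tuple F_sym -(seqF_tuple d2).
Qed.

(** Associativity at the first position, on lists.  By symmetry the inner
    application can be moved elsewhere from there. *)
Lemma seqF_assoc (d b c : X) (u v : seq X) :
  size u = q.+1 -> size v = q ->
  seqF d (seqF d (b :: u) :: c :: v) = seqF d (b :: seqF d (rcons u c) :: v).
Proof.
move=> szu szv; have := F_assoc (nth d (b :: u ++ c :: v)) (p := 0) isT.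
rewrite /nested => nestedE.
transitivity (F [tuple (if k < 0 then nth d (b :: u ++ c :: v) k
            else if k == 0 :> nat
              then F [tuple nth d (b :: u ++ c :: v) (0 + j) | j < q.+2]
            else nth d (b :: u ++ c :: v) (k + q.+1)) | k < q.+2]).
  congr F; apply: eq_from_tnth => -[[|k] ltk]; rewrite !tnth_mktuple /=.
    congr F; apply: eq_from_tnth => -[[|j] ltj]; rewrite !tnth_mktuple //=.
    by rewrite nth_cat szu ifT.
  rewrite -[RHS]/(nth d (u ++ c :: v) (k + q.+1)) nth_cat szu.
  by rewrite ifF ?addnK //; lia.
rewrite nestedE; congr F; apply: eq_from_tnth => -[[|[|k]] ltk];
  rewrite !tnth_mktuple //=.
  congr F; apply: eq_from_tnth => -[j ltj]; rewrite !tnth_mktuple /=.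
  rewrite nth_rcons nth_cat szu.
  case: ltngtP => // [|->]; last by rewrite subnn.
  by rewrite ltnNge -ltnS ltj.
rewrite nth_cat szu ifF; last by lia.
by rewrite -[_ - _]/(k + q.+1 - q)%N -addSnnS addnK.
Qed.

Definition mul_block (a : X) (s : seq X) : X := seqF a (a :: s).

Lemma mul_block_perm (a b : X) (s t : seq X) :
  size s = q.+1 -> perm_eq (a :: s) (b :: t) -> mul_block a s = mul_block b t.
Proof. by move=> szs; apply: seqF_perm; rewrite /= szs. Qed.

(** Two letters on either side of the boundary between two consecutive
    applications of [F] can be exchanged: by associativity both letters may be
    brought inside the same inner application, where symmetry applies. *)
Lemma mul_block_exchange (a b c : X) (u v : seq X) :
  size u = q -> size v = q ->
  mul_block (mul_block a (rcons u b)) (c :: v) =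
  mul_block (mul_block a (rcons u c)) (b :: v).
Proof.
move=> szu szv; rewrite /mul_block.
have szr x : size (rcons u x) = q.+1 by rewrite size_rcons szu.
(* The default value of the outer application becomes that of the inner one. *)
have changed x y : let z := seqF a (a :: rcons u x) in
    seqF z (z :: y :: v) = seqF a (z :: y :: v).
  by apply: seqF_perm; rewrite //= szv.
rewrite /= in changed; rewrite !changed !seqF_assoc //.
congr (seqF a (a :: _ :: v)).
apply: seqF_perm; first by rewrite size_rcons szr.
by apply/seq.permP => p; rewrite -!cats1 !count_cat /=; lia.
Qed.

Fixpoint mul_blocks (k : nat) (a : X) (s : seq X) : X :=
  if k is k'.+1 then mul_blocks k' (mul_block a (take q.+1 s)) (drop q.+1 s)
  else a.

(** The product of the word [a :: s]: the letters of [s] are absorbed by [a] in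
    blocks of q + 1.  Meaningful when q + 1 divides [size s]. *)
Definition prodF (a : X) (s : seq X) : X := mul_blocks (size s %/ q.+1) a s.

Lemma prodF_nil (a : X) : prodF a [::] = a.
Proof. by rewrite /prodF div0n. Qed.

Lemma prodF_block_cat (a : X) (s t : seq X) :
  size s = q.+1 -> prodF a (s ++ t) = prodF (mul_block a s) t.
Proof.
move=> szs; rewrite /prodF size_cat szs divnDl // divnn /=.
by rewrite take_size_cat // drop_size_cat.
Qed.

Lemma prodF_block (a : X) (s : seq X) :
  size s = q.+1 -> prodF a s = mul_block a s.
Proof. by move=> szs; rewrite -[s]cats0 prodF_block_cat // prodF_nil cats0. Qed.

Lemma block_ind (P : seq X -> Prop) :
  P [::] ->
  (forall s t, size s = q.+1 -> q.+1 %| size t -> P t -> P (s ++ t)) ->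
  forall s, q.+1 %| size s -> P s.
Proof.
move=> P0 PS s /dvdnP [k]; elim: k s => [|k IHk] s szs.
  by rewrite (size0nil szs).
have szd : size (drop q.+1 s) = k * q.+1 by rewrite size_drop szs mulSn addKn.
rewrite -[s](cat_take_drop q.+1); apply: PS; last exact: IHk.
  by rewrite size_takel // szs mulSn leq_addr.
by rewrite szd dvdn_mull.
Qed.

Lemma prodF_cat (a : X) (s t : seq X) :
  q.+1 %| size s -> prodF a (s ++ t) = prodF (prodF a s) t.
Proof.
move=> szs; move: s szs a; apply: block_ind => [|s1 s2 szs1 szs2 IHs] a.
  by rewrite prodF_nil.
by rewrite -catA !(prodF_block_cat _ _ szs1) IHs.
Qed.

(** The head of the word lies outside the list of blocks, so exchanging it with
    the next letter happens inside the first application of [F]. *)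
Lemma prodF_swap_head (a b : X) (s : seq X) :
  q.+1 %| (size s).+1 -> prodF a (b :: s) = prodF b (a :: s).
Proof.
move=> szs; have le_q : q <= size s by have := dvdn_leq (ltn0Sn _) szs.
rewrite -[s](cat_take_drop q) -!cat_cons.
have szt : size (take q s) = q by rewrite size_takel.
rewrite !prodF_block_cat /= ?szt //; congr prodF.
apply: mul_block_perm; first by rewrite /= szt.
by apply/seq.permP => p /=; lia.
Qed.

(** Blocks that end before [b] are stripped.  The two letters then either lie in
    the first block, which is symmetric, or straddle its end, which is
    [mul_block_exchange]. *)
Lemma prodF_swap (a : X) (p r : seq X) (b c : X) :
  q.+1 %| size (p ++ b :: c :: r) ->
  prodF a (p ++ b :: c :: r) = prodF a (p ++ c :: b :: r).
Proof.
have [k] := ubnP (size p); elim: k p a => // k IHk p a ltpk szw.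
have [le_p|lt_p] := leqP q.+1 (size p).
  rewrite -[p](cat_take_drop q.+1) -!catA.
  have szt : size (take q.+1 p) = q.+1 by rewrite size_takel.
  rewrite !(prodF_block_cat _ _ szt) IHk //.
    by rewrite size_drop; lia.
  move: szw; rewrite -{1}[p](cat_take_drop q.+1) -catA size_cat szt.
  by rewrite dvdn_addr.
have le_w : q.+1 <= size (p ++ b :: c :: r).
  by apply: dvdn_leq szw; rewrite size_cat addnS.
have [eq_p|ne_p] := eqVneq (size p) q.
  rewrite -(cat_rcons b p) -(cat_rcons c p).
  have szr x : size (rcons p x) = q.+1 by rewrite size_rcons eq_p.
  rewrite !prodF_block_cat //.
  have szr' : q.+1 %| (size r).+1.
    move: szw; rewrite -cat_rcons size_cat szr dvdn_addr //.
  have le_r : q <= size r by have := dvdn_leq (ltn0Sn _) szr'.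
  rewrite -[r](cat_take_drop q) -!cat_cons.
  have szt : size (take q r) = q by rewrite size_takel.
  by rewrite !prodF_block_cat /= ?szt // mul_block_exchange.
have lt_pq : size p < q by lia.
set i := q.+1 - (size p).+2.
have le_i : i <= size r by move: le_w; rewrite size_cat /= /i; lia.
have szt : size (take i r) = i by rewrite size_takel.
have szb x y : size (p ++ x :: y :: take i r) = q.+1.
  by rewrite size_cat /= szt /i; lia.
have split x y : p ++ x :: y :: r = (p ++ x :: y :: take i r) ++ drop i r.
  by rewrite -catA /= cat_take_drop.
rewrite !split !prodF_block_cat //; congr prodF; apply: mul_block_perm => //.
by apply/seq.permP => z; rewrite /= !count_cat /=; lia.
Qed.

Lemma prodF_perm (a b : X) (s t : seq X) :
  q.+1 %| size s -> perm_eq (a :: s) (b :: t) -> prodF a s = prodF b t.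
Proof.
move=> szs eq_st; pose f w := if w is x :: w' then prodF x w' else a.
rewrite -[LHS]/(f (a :: s)) -[RHS]/(f (b :: t)).
apply: (@eq_swap_perm _ _ (size (a :: s))) => // -[|z p] x y r [szr] /=.
  by apply: prodF_swap_head; rewrite szr.
by apply: prodF_swap; rewrite szr.
Qed.

(** * The action of the associated binary band *)

Lemma tuple_prodF (t : q.+2.-tuple X) : F t = prodF (thead t) (behead t).
Proof.
have szt : size (behead t) = q.+1 by rewrite size_behead size_tuple.
rewrite prodF_block // /mul_block -[LHS](seqF_tuple (thead t)).
by congr seqF; apply: (congr1 val (tuple_eta t)).
Qed.

Lemma prodF_nseq (x : X) : prodF x (nseq q.+1 x) = x.
Proof.
have szn : size (nseq q.+1 x) = q.+1 by rewrite size_nseq.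
rewrite prodF_block // /mul_block -[RHS]F_idem; congr F.
apply: eq_from_tnth => i; rewrite !tnth_mktuple.
by rewrite -[x :: _]/(nseq q.+2 x) nth_nseq ltn_ord.
Qed.

(** A letter that is itself a product can be replaced by its factors; this is
    general associativity. *)
Lemma prodF_subst (a b : X) (s r : seq X) :
  q.+1 %| size s -> q.+1 %| (size r).+1 ->
  prodF b (prodF a s :: r) = prodF b (a :: s ++ r).
Proof.
move=> szs szr; rewrite prodF_swap_head // -prodF_cat //.
apply: prodF_perm; first by rewrite size_cat dvdn_add.
by apply/seq.permP => p; rewrite /= !count_cat /=; lia.
Qed.

Lemma prodF_subst_nseq (k : nat) (a b : X) (s r : seq X) :
  q.+1 %| size s -> q.+1 %| k + size r ->
  prodF b (nseq k (prodF a s) ++ r) = prodF b (flatten (nseq k (a :: s)) ++ r).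
Proof.
move=> szs; elim: k r => // k IHk r szr.
rewrite /= prodF_subst //; last by rewrite size_cat size_nseq -addSn.
have szr' : q.+1 %| k + size (a :: s ++ r).
  have -> : k + size (a :: s ++ r) = size s + (k.+1 + size r).
    by rewrite /= size_cat; lia.
  by rewrite dvdn_add.
rewrite -!catA.
transitivity (prodF b (nseq k (prodF a s) ++ a :: s ++ r)).
  apply: prodF_perm.
    by move: szr'; rewrite /= !size_cat size_nseq; congr (_ %| _); lia.
  by apply/seq.permP => p; rewrite /= !count_cat /= count_cat; lia.
rewrite IHk //; apply: prodF_perm.
  have szf : size (flatten (nseq k (a :: s))) = k + k * size s.
    by rewrite size_flatten /shape map_nseq sumn_nseq /= mulSn mulnC.
  have -> : size (flatten (nseq k (a :: s)) ++ a :: s ++ r) =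
      k * size s + (k + size (a :: s ++ r)) by rewrite size_cat szf; lia.
  by rewrite dvdn_add // dvdn_mull.
by apply/seq.permP => p; rewrite /= !count_cat /= !count_cat; lia.
Qed.

Local Notation B := (assoc_binop F).

Lemma binop_prodF (x y : X) : B x y = prodF y (nseq q.+1 x).
Proof.
have szn : size (nseq q.+1 x) = q.+1 by rewrite size_nseq.
rewrite prodF_block // /mul_block.
transitivity (seqF y (rcons (nseq q.+1 x) y)).
  congr F; apply: eq_from_tnth => i; rewrite !tnth_mktuple nth_rcons szn.
  by rewrite nth_nseq; case: ltngtP.
by apply: seqF_perm; rewrite ?perm_rcons // size_rcons szn.
Qed.

Lemma binopxx (x : X) : B x x = x.
Proof. by rewrite binop_prodF prodF_nseq. Qed.

Lemma binopCA (x y b : X) : B x (B y b) = B y (B x b).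
Proof.
rewrite !binop_prodF -!prodF_cat ?size_nseq //; apply: prodF_perm.
  by rewrite size_cat !size_nseq dvdn_add.
by rewrite perm_cons perm_catC.
Qed.

(** In x^(q+1) b one letter x can be expanded into x^(q+2), by idempotency
    of [F]; this gives x^(2q+2) b. *)
Lemma binop_idem (x b : X) : B x (B x b) = B x b.
Proof.
rewrite !binop_prodF -prodF_cat ?size_nseq //.
have := @prodF_subst x b (nseq q.+1 x) (nseq q x).
by rewrite prodF_nseq !size_nseq => flat; rewrite [RHS]flat // -!nseqD -addSnnS.
Qed.

(** The action of a product is the composite of the actions of its factors:
    (x_1 ... x_k)^(q+1) has the same letters as x_1^(q+1) ... x_k^(q+1). *)
Lemma binop_prodFl (a b : X) (s : seq X) :
  q.+1 %| size s -> B (prodF a s) b = foldl (fun c x => B x c) b (a :: s).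
Proof.
move=> szs; transitivity (prodF b (flatten [seq nseq q.+1 x | x <- a :: s])).
  rewrite binop_prodF -[nseq _ _]cats0 prodF_subst_nseq ?addn0 // cats0.
  apply: prodF_perm.
    rewrite size_flatten /shape map_nseq sumn_nseq dvdn_mull //.
  rewrite perm_cons; apply/seq.permP => p.
  rewrite !count_flatten -map_comp map_nseq sumn_nseq.
  elim: (a :: s) => // x l IHl.
  by rewrite -[RHS]/(count p (nseq q.+1 x) + sumn _) -IHl count_nseq -mulnDl.
elim: (a :: s) b => [|x l IHl] b; first by rewrite prodF_nil.
by rewrite map_cons prodF_cat ?size_nseq // IHl -binop_prodF.
Qed.

(** The kernel of x |-> B x, which is another form of the relation
    B y x = x and B x y = y. *)
Definition same_action (x y : X) : Prop := B x =1 B y.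

Lemma foldl_same_action (e b : X) (s : seq X) :
  (forall y, y \in s -> same_action e y) ->
  foldl (fun c x => B x c) (B e b) s = B e b.
Proof.
elim: s => //= y s IHs es.
rewrite -(es y (mem_head y s)) binop_idem; apply: IHs => z sz.
by apply: es; rewrite inE sz orbT.
Qed.

Lemma binopA (x y b : X) : B (B x y) b = B x (B y b).
Proof.
rewrite {1}[B x y]binop_prodF binop_prodFl ?size_nseq //=.
by apply: foldl_same_action => z /nseqP [->].
Qed.

Lemma same_action_semilattice : semilattice_congruence B same_action.
Proof.
split=> [|x y z|x y|x] //; last 3 first.
- by move=> b; rewrite !binopA.
- by move=> b; rewrite !binopA binopCA.
- by move=> b; rewrite binopA binop_idem.
split=> [|x x' y y' exx' eyy' b]; last by rewrite !binopA eyy' exx'.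
split=> [x b|x y exy b|x y z exy eyz b] //; by rewrite exy.
Qed.

(** * The group structure on a class of the least congruence *)

Section Class.

Variable sigma : X -> X -> Prop.
Hypothesis sigma_least : least_semilattice_congruence B sigma.

(** Minimality gives one direction.  Conversely B x = B y gives B y x = x and
    B x y = y, and these two are related by commutativity of the quotient. *)
Lemma least_same_action (x y : X) : sigma x y <-> same_action x y.
Proof.
have [[_ _ sigmaC _] sigma_min] := sigma_least.
split=> [|exy]; first exact: (sigma_min _ same_action_semilattice).
by have := sigmaC y x; rewrite -[B y x]exy binopxx [B x y]exy binopxx.
Qed.

Variable e : X.

Lemma class_prodF (a : X) (s : seq X) :
  q.+1 %| size s -> sigma e a -> (forall y, y \in s -> sigma e y) ->
  sigma e (prodF a s).
Proof.
move=> szs sea ses; apply/least_same_action => b; rewrite binop_prodFl //=.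
have /least_same_action <- := sea.
by rewrite foldl_same_action // => y /ses /least_same_action.
Qed.

Lemma class_absorb (x : X) (k : nat) :
  sigma e x -> prodF x (nseq (k * q.+1) e) = x.
Proof.
move=> /least_same_action eex; elim: k => [|k IHk]; first exact: prodF_nil.
rewrite mulSn nseqD prodF_cat ?size_nseq // -binop_prodF eex binopxx.
exact: IHk.
Qed.

Lemma class_refl : sigma e e.
Proof. exact/least_same_action. Qed.

Lemma class_add_closed (x y : eq_class sigma e) :
  sigma e (prodF (sval x) (sval y :: nseq q e)).
Proof.
apply: class_prodF => [||z]; rewrite /= ?size_nseq //; first exact: svalP.
rewrite inE => /predU1P [->|/nseqP [-> _]]; [exact: svalP|exact: class_refl].
Qed.

Definition class_add (x y : eq_class sigma e) : eq_class sigma e :=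
  exist _ _ (class_add_closed x y).

Lemma class_opp_closed (x : eq_class sigma e) :
  sigma e (prodF e (e :: nseq q (sval x))).
Proof.
apply: class_prodF => [||z]; rewrite /= ?size_nseq //; first exact: class_refl.
rewrite inE => /predU1P [->|/nseqP [-> _]]; [exact: class_refl|exact: svalP].
Qed.

Definition class_opp (x : eq_class sigma e) : eq_class sigma e :=
  exist _ _ (class_opp_closed x).

Definition class_zero : eq_class sigma e := exist _ e class_refl.

Lemma class_addA : associative class_add.
Proof.
move=> x y z; apply: sval_inj => /=.
rewrite prodF_subst -?prodF_cat /= ?size_nseq //.
apply: prodF_perm.
  by rewrite /= size_cat /= !size_nseq -addnS -addSn dvdn_add.
by apply/seq.permP => p; rewrite /= !count_cat /=; lia.
Qed.

Lemma class_addC : commutative class_add.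
Proof.
by move=> x y; apply: sval_inj; rewrite /= prodF_swap_head ?size_nseq.
Qed.

Lemma class_add0 : left_id class_zero class_add.
Proof.
move=> x; apply: sval_inj; rewrite /= prodF_swap_head ?size_nseq //.
rewrite -[e :: _]/(nseq q.+1 e) -[q.+1]mul1n class_absorb //; exact: svalP.
Qed.

Lemma prodF_nseq_class (x : X) (k : nat) :
  sigma e x -> prodF e (nseq q.+1 x ++ nseq (k * q.+1) e) = e.
Proof.
move=> sex; have /least_same_action eex := sex.
rewrite prodF_cat ?size_nseq // -binop_prodF -eex binopxx.
exact: class_absorb class_refl.
Qed.

Lemma class_addN : left_inverse class_zero class_opp class_add.
Proof.
move=> x; apply: sval_inj; rewrite /= -prodF_cat /= ?size_nseq //.
apply: etrans (prodF_nseq_class 1 (svalP x)); apply: prodF_perm.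
  by rewrite /= size_cat /= !size_nseq -addSn dvdn_add.
by apply/seq.permP => p; rewrite mul1n /= !count_cat /=; lia.
Qed.

(** The empty sum contributes the head letter e and every summand brings its q
    letters e. *)
Lemma class_sum (cG : GRing.Zmodule (eq_class sigma e)) :
  let G : zmodType := GRing.Zmodule.Pack cG in
  (0%R = class_zero :> G) ->
  (forall x y : G, (x + y)%R = class_add x y) ->
  forall l : seq G,
    sval (\sum_(x <- l) x)%R =
    prodF e ([seq sval x | x <- l] ++ nseq (size l * q) e).
Proof.
move=> G G0 GD; elim=> [|x l IHl]; first by rewrite big_nil G0 prodF_nil.
rewrite big_cons GD /= IHl.
have szl : q.+1 %| size ([seq sval x | x <- l] ++ nseq (size l * q) e).
  by rewrite size_cat size_map size_nseq -mulnS dvdn_mull.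
rewrite prodF_subst // ?size_nseq //; apply: prodF_perm.
  by rewrite /= size_cat size_nseq -addnS dvdn_add.
by apply/seq.permP => p; rewrite /= !count_cat mulSn nseqD count_cat; lia.
Qed.

Lemma tuple_closed (s : q.+2.-tuple (eq_class sigma e)) :
  sigma e (F [tuple sval (tnth s k) | k < q.+2]).
Proof.
rewrite tuple_prodF; set t := mktuple _.
have st y : y \in t -> sigma e y by move=> /mapP [k _ ->]; apply: svalP.
apply: class_prodF => [||y /mem_behead]; last exact: st.
  by rewrite size_behead size_tuple.
exact/st/mem_tnth.
Qed.

Lemma class_group :
  exists H : q.+2.-tuple (eq_class sigma e) -> eq_class sigma e,
    is_restriction F H /\ is_nary_extension_of_abelian_group H q.+1.
Proof.
exists (fun s => exist _ _ (tuple_closed s)); split=> //.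
have [cG [G0 GD]] :=
  abelian_group_on class_addA class_addC class_add0 class_addN.
exists cG => G; split=> [s|x]; apply: sval_inj.
  rewrite /nary_extension /= -(big_tuple _ _ _ xpredT id) (class_sum G0 GD).
  set t := mktuple _.
  have tE : [seq sval x | x <- s] = t.
    by rewrite -[tval s]map_tnth_enum -map_comp.
  have szt : size (behead t) = q.+1 by rewrite size_behead size_tuple.
  have Ft : F t = prodF (thead t) (behead t) by exact: tuple_prodF.
  have {tE} -> : [seq sval x | x <- s] = thead t :: behead t.
    by rewrite tE; apply: (congr1 val (tuple_eta t)).
  transitivity (prodF (F t) (nseq (q.+1 * q.+1) e)).
    by rewrite class_absorb //; apply: tuple_closed.
  rewrite Ft size_tuple -prodF_cat ?szt //; apply: prodF_perm.
    by rewrite size_cat size_nseq szt dvdn_add ?dvdn_mull.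
  (* The head letter e of the sum is the extra one on the right. *)
  have -> : q.+1 * q.+1 = (q.+2 * q).+1 by lia.
  by apply/seq.permP => p; rewrite /= !count_cat /=; lia.
have -> : (x *+ q.+1)%R = (\sum_(y <- nseq q.+1 x) y)%R :> G.
  by rewrite big_nseq GRing.iter_addr_0.
rewrite (class_sum G0 GD) G0 map_nseq size_nseq mulnC.
exact: prodF_nseq_class (svalP x).
Qed.

End Class.

End SymmetricBand.

Theorem proposition4p6 (X : Type) (n : nat) (F : n.-tuple X -> X)
    (sigma : X -> X -> Prop) :
  1 < n ->
  symmetric_nary_band F ->
  least_semilattice_congruence (assoc_binop F) sigma ->
  forall x : X,
    exists H : n.-tuple (eq_class sigma x) -> eq_class sigma x,
      is_restriction F H /\ is_nary_extension_of_abelian_group H n.-1.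
Proof.
case: n F => [|[|q]] // F _ [F_assoc F_sym F_idem] sigma_least x.
(* Counting letters needs decidable equality on X, obtained classically. *)
exact: (@class_group {classic X} q F F_assoc F_sym F_idem sigma sigma_least x).
Qed.
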